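(* Let $n\ge 2$ and $s\ge 1$ be integers, and let $q=\lfloor s/n\rfloor$ and $r=s-qn$ be the quotient and remainder when $s$ is divided by $n$. Then \[ f(n,s)\le\begin{cases} \dfrac{s(n-1)}{2} & \text{if } r=0,\\[2mm] \dfrac{s(n-1)}{2}+\dfrac{r(n-3)}{2}+1 & \text{otherwise.}\end{cases} \] Moreover, in the case $n=2$ (so that $r$ is the remainder of $s$ modulo $2$), $f(2,s)\le (s-r)/2$ for all $s$.
   Context: Let $N=\{1,\dots,n\}$ be a set of $n\ge 2$ agents and $M$ a finite set of indivisible goods. Each agent $i$ has an additive utility function $u_i:2^M\to\mathbb{R}_{\ge 0}$, i.e., $u_i(M')=\sum_{g\in M'}u_i(\{g\})$. An instance consists of $N$, $M$ and $(u_i)_{i\in N}$. An allocation $\mathcal{A}=(A_1,\dots,A_n)$ is an ordered partition of $M$ into $n$ (possibly empty) bundles, $A_i$ going to agent $i$; it is $s$-balanced if $|A_i|=s$ for all $i\in N$. Agent $i$ is EF1 towards agent $j$ in $\mathcal{A}$ if $A_j=\varnothing$ or there exists $g\in A_j$ with $u_i(A_i)\ge u_i(A_j\setminus\{g\})$. $\mathcal{A}$ is EF1 if every agent is EF1 towards every other agent. An exchange transforms an allocation $\mathcal{A}$ into an allocation $\mathcal{B}$ where, for some distinct $i,j\in N$, $g\in A_i$, $g'\in A_j$, we have $B_i=(A_i\cup\{g'\})\setminus\{g\}$, $B_j=(A_j\cup\{g\})\setminus\{g'\}$, and $B_k=A_k$ for $k\ne i,j$. $f(n,s)$ denotes the smallest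 integer such that for every instance with $n$ agents and $ns$ goods and every $s$-balanced allocation $\mathcal{A}$ in the instance, some EF1 allocation can be reached from $\mathcal{A}$ using at most $f(n,s)$ exchanges. *)

(* Defs.v *)
From HB Require Import structures.
From mathcomp Require Import all_boot all_order all_algebra.
From mathcomp Require Import reals.

Set Implicit Arguments.
Unset Strict Implicit.
Unset Printing Implicit Defensive.

Import Order.TTheory GRing.Theory Num.Theory.
Local Open Scope ring_scope.

Section Allocations.

Context {R : realType} {n : nat} {M : finType}.

Definition additive_utilities (u : 'I_n -> {set M} -> R) : Prop :=
  (forall i S, 0 <= u i S) /\
  (forall i S, u i S = \sum_(g in S) u i [set g]).

(* Ordered partitions of the goods; empty bundles are allowed. *)
Definition is_allocation (A : {ffun 'I_n -> {set M}}) : Prop :=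
  \bigcup_i A i = [set: M] /\
  (forall i j, i != j -> [disjoint A i & A j]).

Definition balanced (s : nat) (A : {ffun 'I_n -> {set M}}) : Prop :=
  forall i, #|A i| = s.

Definition EF1_towards (u : 'I_n -> {set M} -> R)
    (A : {ffun 'I_n -> {set M}}) (i j : 'I_n) : Prop :=
  A j = set0 \/ exists2 g, g \in A j & u i (A j :\ g) <= u i (A i).

Definition EF1 (u : 'I_n -> {set M} -> R)
    (A : {ffun 'I_n -> {set M}}) : Prop :=
  forall i j, i != j -> EF1_towards u A i j.

Definition exchange : rel {ffun 'I_n -> {set M}} := fun A B =>
  [exists i : 'I_n, exists j : 'I_n, exists g in A i, exists g' in A j,
    [&& i != j,
        B i == (A i :|: [set g']) :\ g,
        B j == (A j :|: [set g]) :\ g'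
      & [forall k : 'I_n, (k != i) && (k != j) ==> (B k == A k)]]].

Definition EF1_reachable_within (u : 'I_n -> {set M} -> R)
    (A : {ffun 'I_n -> {set M}}) (k : nat) : Prop :=
  exists p : seq {ffun 'I_n -> {set M}},
    [/\ path exchange A p, (size p <= k)%N,
        is_allocation (last A p) & EF1 u (last A p)].

End Allocations.

Definition exchanges_suffice (R : realType) (n s k : nat) : Prop :=
  forall (M : finType) (u : 'I_n -> {set M} -> R)
         (A : {ffun 'I_n -> {set M}}),
    #|M| = (n * s)%N -> additive_utilities u ->
    is_allocation A -> balanced s A -> EF1_reachable_within u A k.

(* [is_f R n s k] says that f(n, s) exists and equals k. The number f(n, s) is
   given by this relation because a total function would need a junk value in
   case no number of exchanges sufficed. *)
Definition is_f (R : realType) (n s k : nat) : Prop :=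
  exchanges_suffice R n s k /\
  (forall k', exchanges_suffice R n s k' -> (k <= k')%N).

(* Main.v *)
Require Import Defs.
From mathcomp Require Import all_boot all_order all_algebra.
From mathcomp Require Import reals.
From mathcomp Require Import perm boolp zify lra.

(** Split the goods into [s] categories of [n] goods: [q] categories inside
    each [A_i], and [r] further ones cutting the [r * n] remaining goods,
    listed owner by owner, into consecutive blocks. Letting the agents pick one
    good per category, after the elimination of envy cycles, yields an EF1
    allocation [B] that gives every agent one good of each category.

    In the multigraph with an edge from the owner in [A] to the owner in [B] of
    each good, a closed trail of length [l] is settled by [l - 1] exchanges. The
    goods of pure categories form loops and 2-cycles, which cost
    [q * n * (n - 1) / 2] exchanges. Each mixed category contains a cycle; as
    the blocks are consecutive, these [r] cycles have total length at most
    [n + r - 1], and the remaining balanced graph splits into cycles of length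
    at most [n], hence into at least [r - 1] of them. So the mixed goods cost at
    most [r * n - (2 * r - 1)] exchanges.

    For [n = 2] and odd [s], each agent has a perfect matching of the goods such
    that any 2-colouring separating the matched pairs is EF1 for that agent,
    and the union of the two matchings is 2-colourable. *)

Set Implicit Arguments.
Unset Strict Implicit.
Unset Printing Implicit Defensive.

Import Order.TTheory GRing.Theory Num.Theory.
Local Open Scope ring_scope.

(** * The cost of settling goods by exchanges *)

Section Exchanges.

Context {n : nat} {M : finType}.
Implicit Types (a b : {ffun M -> 'I_n}) (D : {set M}) (k m : nat).

(** Allocations are handled through their owner functions, so that an exchange becomes composition
    with a transposition of goods. *)
Definition bundles a : {ffun 'I_n -> {set M}} :=
  [ffun i => [set g | a g == i]].

Lemma bundles_allocation a : is_allocation (bundles a).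
Proof.
split=> [|i j neq_ij].
  by apply/setP=> g; rewrite inE; apply/bigcupP; exists (a g); rewrite ?ffunE ?inE.
rewrite -setI_eq0; apply/eqP/setP=> g; rewrite !ffunE !inE.
by apply: contraNF neq_ij => /andP[/eqP<- /eqP<-].
Qed.

Lemma allocation_bundles (A : {ffun 'I_n -> {set M}}) :
  is_allocation A -> exists a, A = bundles a.
Proof.
case=> coverA disjA.
have owner g : exists i, g \in A i.
  have: g \in \bigcup_i A i by rewrite coverA.
  by case/bigcupP=> i _; exists i.
have [a Aa] := fin_all_exists owner; exists (finfun a).
apply/ffunP=> i; apply/setP=> g; rewrite ffunE inE ffunE.
apply/idP/eqP=> [Aig | <-//]; apply/eqP; apply: contraTT Aig => /disjA.
by move/pred0P/(_ g) => /=; rewrite Aa /= => ->.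
Qed.

Definition swap a (g h : M) : {ffun M -> 'I_n} := [ffun x => a (tperm g h x)].

Lemma exchange_swap a g h :
  a g != a h -> exchange (bundles a) (bundles (swap a g h)).
Proof.
move=> neq_gh; have neq_hg := neq_gh; rewrite eq_sym in neq_hg.
have g'h : (g == h) = false by apply: contraNF neq_gh => /eqP->.
apply/existsP; exists (a g); apply/existsP; exists (a h).
apply/existsP; exists g; rewrite ffunE inE eqxx /=.
apply/existsP; exists h; rewrite ffunE inE eqxx /= neq_gh /=.
apply/and3P; split.
- apply/eqP/setP=> x; rewrite !ffunE !inE ffunE.
  case: tpermP => [->|->|/eqP/negPf-> /eqP/negPf->]; last by rewrite orbF.
    by rewrite (negPf neq_hg) eqxx.
  by rewrite !eqxx orbT eq_sym g'h.
- apply/eqP/setP=> x; rewrite !ffunE !inE ffunE.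
  case: tpermP => [->|->|/eqP/negPf-> /eqP/negPf->]; last by rewrite orbF.
    by rewrite !eqxx orbT g'h.
  by rewrite (negPf neq_gh) eqxx.
apply/forallP=> i; apply/implyP=> /andP[neq_ig neq_ih].
apply/eqP/setP=> x; rewrite !ffunE !inE ffunE.
by case: tpermP => // ->; rewrite ![_ == i]eq_sym (negPf neq_ig) (negPf neq_ih).
Qed.

Definition reach k a a' : Prop :=
  exists p, [/\ path exchange (bundles a) p, (size p <= k)%N
             & last (bundles a) p = bundles a'].

Lemma reach_refl a : reach 0 a a.
Proof. by exists [::]. Qed.

Lemma reach_trans a1 a2 a3 k1 k2 :
  reach k1 a1 a2 -> reach k2 a2 a3 -> reach (k1 + k2) a1 a3.
Proof.
move=> [p1 [path1 size1 last1]] [p2 [path2 size2 last2]]; exists (p1 ++ p2).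
by rewrite cat_path path1 last1 path2 last_cat last1 last2 size_cat leq_add.
Qed.

(** If both goods have the same owner, no exchange is possible, but the swap changes nothing and the
    empty path serves. *)
Lemma reach_swap a g h : reach 1 a (swap a g h).
Proof.
have [eq_gh | neq_gh] := eqVneq (a g) (a h); last first.
  by exists [:: bundles (swap a g h)]; rewrite /= exchange_swap.
exists [::]; split=> //=; congr bundles; apply/ffunP=> x; rewrite ffunE.
by case: tpermP => [->|->|].
Qed.

Definition override D a b : {ffun M -> 'I_n} :=
  [ffun x => if x \in D then b x else a x].

(** With each good [g] viewed as an edge from [a g] to [b g], this says that the edge [y] starts
    where the edge [x] ends. *)
Definition trail a b := [rel x y : M | b x == a y].

Lemma path_trail_eq a1 a2 b g (c : seq M) :
  {in c, a1 =1 a2} -> path (trail a1 b) g c = path (trail a2 b) g c.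
Proof.
elim: c g => //= h c IHc g eq_a; rewrite eq_a ?mem_head // IHc // => x cx.
by rewrite eq_a // inE cx orbT.
Qed.

(** Swapping [g] with its successor [h] gives [g] its final owner and makes [h] start at the old
    owner of [g], which closes the shorter trail [h :: c]. The last good is settled for free, hence
    [size c] exchanges. *)
Lemma reach_path (c : seq M) g a b :
    uniq (g :: c) -> path (trail a b) g c -> b (last g c) = a g ->
  reach (size c) a (override [set x in g :: c] a b).
Proof.
elim: c g a => [|h c IHc] g a.
  move=> _ _ /= bg; suff ->: override [set x in [:: g]] a b = a.
    exact: reach_refl.
  by apply/ffunP=> x; rewrite ffunE !inE; case: eqP => // ->.
move=> uniq_ghc /= /andP[/eqP bg path_c] last_c.
have := uniq_ghc; rewrite cons_uniq => /andP[g_hc uniq_hc].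
have := uniq_hc; rewrite cons_uniq => /andP[h_c _].
have := g_hc; rewrite inE negb_or => /andP[g'h g_c].
rewrite -addn1 addnC; apply: reach_trans (reach_swap a g h) _.
have -> : override [set x in [:: g, h & c]] a b
        = override [set x in h :: c] (swap a g h) b.
  apply/ffunP=> x; rewrite !ffunE !inE.
  case: tpermP => [->|->|/eqP/negPf-> _] //; last by rewrite eqxx !orbT.
  by rewrite eqxx bg (negPf g'h) (negPf g_c).
apply: IHc => //; last by rewrite last_c ffunE tpermR.
rewrite (path_trail_eq (a2 := a)) // => x cx; rewrite ffunE tpermD //.
  by apply: contraNneq g_c => ->.
by apply: contraNneq h_c => ->.
Qed.

(* Quantifying over [a'] lets disjoint sets be settled one after the other. *)
Definition fixable a b D k : Prop :=
  forall a', {in D, a' =1 a} -> reach k a' (override D a' b).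

Lemma fixable_cycle a b (c : seq M) :
  uniq c -> cycle (trail a b) c -> fixable a b [set x in c] (size c).-1.
Proof.
case: c => [|g c] uniq_c.
  move=> _ a' _; suff ->: override [set x in [::]] a' b = a' by apply: reach_refl.
  by apply/ffunP=> x; rewrite ffunE !inE.
rewrite /= rcons_path => /andP[path_c /eqP last_c] a' eq_a.
apply: reach_path => //; last by rewrite last_c eq_a // inE mem_head.
by rewrite (path_trail_eq (a2 := a)) // => x cx; rewrite eq_a // inE mem_behead.
Qed.

Lemma fixable0 a b D : {in D, a =1 b} -> fixable a b D 0.
Proof.
move=> eq_ab a' eq_a; suff ->: override D a' b = a' by apply: reach_refl.
by apply/ffunP=> x; rewrite ffunE; case: ifP => // Dx; rewrite eq_a ?eq_ab.
Qed.

Lemma fixableU a b D1 D2 k1 k2 :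
    [disjoint D1 & D2] -> fixable a b D1 k1 -> fixable a b D2 k2 ->
  fixable a b (D1 :|: D2) (k1 + k2).
Proof.
move=> disj fix1 fix2 a' eq_a.
apply: reach_trans (fix1 a' _) _.
  by move=> x D1x; apply: eq_a; rewrite inE D1x.
have -> : override (D1 :|: D2) a' b = override D2 (override D1 a' b) b.
  by apply/ffunP=> x; rewrite !ffunE inE; do 2!case: (x \in _).
apply: fix2 => x D2x; rewrite ffunE (disjointFl disj) // eq_a //.
by rewrite inE D2x orbT.
Qed.

Lemma fixable_leq a b D k1 k2 :
  (k1 <= k2)%N -> fixable a b D k1 -> fixable a b D k2.
Proof.
move=> le_k fix1 a' eq_a; have [p [path_p size_p last_p]] := fix1 a' eq_a.
by exists p; split=> //; apply: leq_trans le_k.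
Qed.

Lemma fixableT a b k : fixable a b [set: M] k -> reach k a b.
Proof.
move/(_ a (fun x _ => erefl)); suff ->: override [set: M] a b = b by [].
by apply/ffunP=> x; rewrite ffunE inE.
Qed.

(* Choose for each agent a good of [D] that [b] gives to that agent; mapping
   the agent to the owner in [a] of this good is eventually periodic. *)
Lemma exists_cycle a b D :
    D != set0 -> (forall g, g \in D -> exists2 h, h \in D & b h = a g) ->
  exists c : seq M, [/\ c != [::], {subset c <= D}, uniq (map a c)
                      & cycle (trail a b) c].
Proof.
move=> /set0Pn[g0 Dg0] predD.
pose G i := odflt g0 [pick h in D | b h == i].
have DG i : G i \in D by rewrite /G; case: pickP => //= h /andP[].
have bG g : g \in D -> b (G (a g)) = a g.
  move=> /predD[h Dh bh]; rewrite /G; case: pickP => [h' /andP[_ /eqP] //|].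
  by move/(_ h); rewrite Dh bh eqxx.
pose f i := a (G i).
(* The iterates of [f] from [a g0] return at step [order f (a g0)] to the value of step [k], so this
   value [i] is periodic. *)
have [k lt_k eq_k] := trajectP (looping_order f (a g0)).
pose i := iter k f (a g0).
have cyc_i : fcycle f (orbit f i).
  apply/(orbitPcycle (f := f) (x := i) 3 0); exists (order f (a g0) - k).-1.
  by rewrite prednK ?subn_gt0 // /i -iterD subnK // ltnW.
have in_i j : j \in orbit f i -> exists2 g, g \in D & j = a g.
  rewrite -fconnect_orbit => /iter_findex <-; rewrite /i -iterD.
  by case: (_ + _)%N => [|m]; [exists g0 | exists (G (iter m f (a g0)))].
(* Since [b (G (f j)) = f j = a (G j)], following [f] walks the trail backwards; hence the
   reversal. *)
exists (rev (map G (orbit f i))); split.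
- by rewrite -size_eq0 size_rev size_map size_orbit -lt0n order_gt0.
- by move=> x; rewrite mem_rev => /mapP[j _ ->].
- rewrite map_rev rev_uniq -map_comp -/f map_inj_in_uniq ?orbit_uniq //.
  by apply/(orbitPcycle (f := f) (x := i) 0 5).
rewrite rev_cycle cycle_map; apply: (sub_in_cycle (P := [in orbit f i])) cyc_i; last by apply/allP.
move=> j l /in_i[g Dg ->] /in_i[h Dh ->] /= /eqP eq_f.
by rewrite bG // -eq_f.
Qed.

(* This holds in particular when [D] is the disjoint union of [m] closed
   trails. *)
Definition trails a b D m : Prop :=
  exists2 k, (k + m <= #|D|)%N & fixable a b D k.

Lemma trailsU a b D1 D2 m1 m2 :
    [disjoint D1 & D2] -> trails a b D1 m1 -> trails a b D2 m2 ->
  trails a b (D1 :|: D2) (m1 + m2).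
Proof.
move=> disj [k1 le1 fix1] [k2 le2 fix2]; exists (k1 + k2)%N.
  by rewrite cardsU disjoint_setI0 // cards0 subn0 addnACA leq_add.
exact: fixableU.
Qed.

Lemma trails_bigcup a b (I : finType) (D : I -> {set M}) :
    (forall i j, i != j -> [disjoint D i & D j]) ->
    (forall i, trails a b (D i) 1) ->
  trails a b (\bigcup_i D i) #|I|.
Proof.
move=> disjD trD; pose U (s : seq I) := \bigcup_(i <- s) D i.
rewrite cardE -[\bigcup_i D i]big_enum -/(U (enum I)).
elim: (enum I) (enum_uniq I) => [_ | i s IHs /= /andP[s_i /IHs tr_s]].
  rewrite /U big_nil; exists 0%N => //; apply: fixable0 => x; by rewrite inE.
rewrite /U big_cons -add1n; apply: trailsU => //.
rewrite -setI_eq0 big_distrr /= big_seq big1 // => j s_j.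
by apply/eqP; rewrite setI_eq0; apply: disjD; apply: contraNneq s_i => ->.
Qed.

Lemma trails_cycle a b (c : seq M) :
  c != [::] -> uniq c -> cycle (trail a b) c -> trails a b [set x in c] 1.
Proof.
move=> c_n0 uniq_c cyc_c; exists (size c).-1; last exact: fixable_cycle.
by rewrite cardsE (card_uniqP uniq_c) addn1 prednK // lt0n size_eq0.
Qed.

Lemma card_set_seq (c : seq M) (P : pred M) :
  uniq c -> #|[set g in [set x in c] | P g]| = count P c.
Proof.
move=> uniq_c; rewrite -size_filter -(card_uniqP (filter_uniq _ uniq_c)).
by apply: eq_card => x; rewrite !inE mem_filter andbC.
Qed.

Lemma card_setD_cond (C D : {set M}) (P : pred M) : C \subset D ->
  #|[set g in D :\: C | P g]| = (#|[set g in D | P g]| - #|[set g in C | P g]|)%N.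
Proof.
move=> sCD; rewrite -cardsDS; last first.
  by apply/subsetP=> x; rewrite !inE => /andP[/(subsetP sCD)-> ->].
by apply: eq_card => x; rewrite !inE; case: (x \in C); case: (P x);
  rewrite ?andbF ?andbT.
Qed.

Definition balanced_on a b D : Prop :=
  forall i, #|[set g in D | a g == i]| = #|[set g in D | b g == i]|.

(** Along a closed trail, the owners in [b] are the owners in [a] shifted by one position. *)
Lemma balanced_cycle a b (c : seq M) :
  uniq c -> cycle (trail a b) c -> balanced_on a b [set x in c].
Proof.
move=> uniq_c cyc_c i.
rewrite !card_set_seq //.
suff /seq.permP/(_ (pred1 i)): perm_eq (map a c) (map b c) by rewrite !count_map.
rewrite perm_sym.
case: c cyc_c {uniq_c} => [|g c] //= cyc_c.
suff ->: b g :: map b c = map a (rcons c g).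
  by rewrite map_rcons perm_rcons.
elim: c {1 3}g cyc_c => [|h c IHc] x /=; first by case/andP=> /eqP->.
by case/andP=> /eqP-> /IHc->.
Qed.

Lemma balancedD a b (C D : {set M}) :
    C \subset D -> balanced_on a b D -> balanced_on a b C ->
  balanced_on a b (D :\: C).
Proof.
by move=> sCD balD balC i; rewrite !card_setD_cond // balD balC.
Qed.

(** Balance gives each good a predecessor, so a cycle can be removed, and balance persists. Such a
    cycle leaves each agent at most once, so it has at most [n] goods. *)
Lemma trails_balanced a b D :
  balanced_on a b D -> exists2 m, trails a b D m & (#|D| <= n * m)%N.
Proof.
move: {2}#|D|.+1 (ltnSn #|D|) => N; elim: N D => // N IHN D ltDN balD.
have [-> | D_n0] := eqVneq D set0.
  exists 0%N; last by rewrite cards0.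
  by exists 0%N; rewrite ?cards0 //; apply: fixable0 => x; rewrite inE.
have [g Dg | c [c_n0 sub_c uniq_ac cyc_c]] := exists_cycle D_n0 (a := a) (b := b).
  have: (0 < #|[set h in D | a h == a g]|)%N.
    by apply/card_gt0P; exists g; rewrite inE Dg /=.
  by rewrite balD => /card_gt0P[h]; rewrite inE => /andP[Dh /eqP]; exists h.
have uniq_c := map_uniq uniq_ac; pose C := [set x in c].
have sCD : C \subset D by apply/subsetP=> x; rewrite inE; apply: sub_c.
have cardC : #|C| = size c by rewrite cardsE (card_uniqP uniq_c).
have le_cn : (size c <= n)%N.
  by rewrite -(size_map a) -(card_uniqP uniq_ac) -[X in (_ <= X)%N]card_ord max_card.
have c_gt0 : (0 < size c)%N by rewrite lt0n size_eq0.
have cardD : (#|D :\: C| = #|D| - size c)%N by rewrite cardsDS ?cardC.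
have leCD := subset_leq_card sCD.
have [||m tr_m le_m] := IHN (D :\: C).
- by rewrite cardD; lia.
- by apply: balancedD => //; apply: balanced_cycle.
exists (1 + m)%N; last by rewrite mulnDr muln1; lia.
rewrite -(setID D C) (setIidPr sCD); apply: trailsU => //.
  by rewrite -setI_eq0 setIDA setIC -setIDA setDv setI0.
exact: trails_cycle.
Qed.

(** Goods going from [i] to [j] pair up with goods going back, and one exchange settles such a pair;
    loops cost nothing. *)
Lemma fixable_symmetric a b D :
    (forall i j, #|[set g in D | (a g == i) && (b g == j)]|
               = #|[set g in D | (a g == j) && (b g == i)]|) ->
  fixable a b D #|[set g in D | a g != b g]|./2.
Proof.
move: {2}#|D|.+1 (ltnSn #|D|) => N; elim: N D => // N IHN D ltDN symD.
set E := [set g in D | _].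
have [E0 | [g]] := set_0Vmem E.
  rewrite E0 cards0; apply: fixable0 => g Dg; apply/eqP.
  by apply: contraFT (in_set0 g) => ab_g; rewrite -E0 inE Dg.
rewrite inE => /andP[Dg ab_g].
have [h]: exists h, h \in [set h in D | (a h == b g) && (b h == a g)].
  by apply/card_gt0P; rewrite symD; apply/card_gt0P; exists g; rewrite inE Dg !eqxx.
rewrite !inE => /and3P[Dh /eqP ah /eqP bh].
have neq_gh : g != h by apply: contraNneq ab_g => eq_gh; rewrite {1}eq_gh ah.
pose C := [set x in [:: g; h]].
have sCD : C \subset D.
  by apply/subsetP=> x; rewrite !inE => /orP[] /eqP->.
have uniq_c : uniq [:: g; h] by rewrite /= inE neq_gh.
have cyc_c : cycle (trail a b) [:: g; h] by rewrite /= ah bh !eqxx.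
have cardC : #|C| = 2%N by rewrite cardsE (card_uniqP uniq_c).
have cardE : #|E| = #|[set x in D :\: C | a x != b x]|.+2.
  rewrite -(cardsID C) addnC -addn2; congr (_ + _)%N.
    by apply: eq_card => x; rewrite !inE; case: (_ || _); rewrite ?andbF ?andbT.
  rewrite -cardC; apply: eq_card => x; rewrite !inE.
  case: (eqVneq x g) => [->|_] /=; first by rewrite Dg ab_g.
  by case: (eqVneq x h) => [->|_]; rewrite ?andbF // Dh ah bh eq_sym ab_g.
rewrite cardE /= -add1n.
have {1}->: D = C :|: D :\: C by rewrite -{1}(setID D C) (setIidPr sCD).
apply: fixableU.
- by rewrite -setI_eq0 setIDA setIC -setIDA setDv setI0.
- exact: fixable_cycle cyc_c.
apply: IHN => [|i j]; first by rewrite cardsDS // cardC; have := subset_leq_card sCD; lia.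
rewrite !card_setD_cond // symD !card_set_seq //= ah bh !addn0; congr (_ - _)%N.
by rewrite addnC ![(b g == _) && _]andbC.
Qed.

End Exchanges.

(** * EF1 allocations with one good of each category per agent *)

Section RoundRobin.

Context {R : realType} {n : nat} {M : finType}.
Implicit Types (b : {ffun M -> 'I_n}) (w : 'I_n -> M -> R).

(** Here [V i k] is the value of bundle [k] to agent [i], and [p i] is the bundle that [i] holds. *)
Definition envy (V : 'I_n -> 'I_n -> R) (p : {perm 'I_n}) : rel 'I_n :=
  [rel i j | V i (p i) < V i (p j)].

(* Among the rearrangements that hurt nobody, one of maximal total utility
   admits no envy cycle, since rotating along it would increase the total. *)
Lemma acyclic_envy (V : 'I_n -> 'I_n -> R) :
  exists p : {perm 'I_n}, (forall i, V i i <= V i (p i)) /\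
    (forall i j, envy V p i j -> ~~ connect (envy V p) j i).
Proof.
pose P (p : {perm 'I_n}) := [forall i, V i i <= V i (p i)].
have P1 : P 1%g by apply/forallP=> i; rewrite perm1.
have [p /forallP Pp max_p] := arg_maxP (fun p : {perm 'I_n} => \sum_i V i (p i)) P1.
exists p; split=> // i j e_ij; apply/negP=> /connectP[c path_c last_c].
have [c' cyc_c uniq_c] : exists2 c', cycle (envy V p) (j :: c') & uniq (j :: c').
  move: last_c; case/shortenP: path_c => c' path_c' uniq_c' _ last_c.
  by exists c'; rewrite //= rcons_path path_c' -last_c.
(* [q] sends each agent of the envy cycle to the next, whom it envies, and fixes the others. *)
pose q := perm (can_inj (prev_next uniq_c)).
have le_q k : V k (p k) <= V k (p (q k)).
  rewrite permE; have [c_k | c'k] := boolP (k \in j :: c').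
    exact/ltW/(next_cycle cyc_c c_k).
  by rewrite next_nth (negPf c'k).
have /max_p : P (q * p)%g.
  by apply/forallP=> k; rewrite permM; apply: le_trans (Pp k) (le_q k).
apply/negP; rewrite -ltNge (bigD1 j) //= [ltRHS](bigD1 j) //=.
apply: ltr_leD; last by apply: ler_sum => k _; rewrite permM.
by rewrite permM permE; apply: (next_cycle cyc_c); apply: mem_head.
Qed.

(** The agents take their favourite remaining good in order of increasing rank, ties being broken
    arbitrarily. *)
Lemma picking w (rk : 'I_n -> nat) (x0 : M) (S : {set 'I_n}) (G : {set M}) :
    #|G| = #|S| ->
  exists f : 'I_n -> M,
    [/\ {in S, forall i, f i \in G}, {in S &, injective f}
      & {in S &, forall i j, (rk i < rk j)%N -> w i (f j) <= w i (f i)}].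
Proof.
move: {2}#|S| (erefl #|S|) => m; elim: m S G => [|m IHm] S G cardS cardG.
  have inS i : i \in S = false by rewrite (cards0_eq cardS) inE.
  by exists (fun=> x0); split=> [i|i j|i j]; rewrite inS.
have [i1 Si1] : exists i, i \in S by apply/card_gt0P; rewrite cardS.
have [g1 Gg1] : exists g, g \in G by apply/card_gt0P; rewrite cardG cardS.
have [i /= Si min_i] := @arg_minnP _ i1 [in S] rk Si1.
have [g /= Gg max_g] := @arg_maxP _ _ _ g1 [in G] (w i) Gg1.
have [||f [fG f_inj f_best]] := IHm (S :\ i) (G :\ g).
- by have := cardsD1 i S; rewrite Si cardS => -[].
- have := cardsD1 i S; have := cardsD1 g G; rewrite Si Gg cardG cardS; lia.
exists (fun j => if j == i then g else f j); split=> [j Sj | j l Sj Sl | j l Sj Sl].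
- case: eqP => // /eqP neq_ji.
  by have := fG j; rewrite !inE neq_ji Sj => /(_ isT)/andP[].
- have fg k : k \in S -> k != i -> f k != g.
    by move=> Sk ki; have := fG k; rewrite !inE Sk ki => /(_ isT)/andP[].
  case: (eqVneq j i) (eqVneq l i) => [->|ji] [->|li] // eq_f.
  + by have := fg l Sl li; rewrite eq_f eqxx.
  + by have := fg j Sj ji; rewrite eq_f eqxx.
  by apply: f_inj; rewrite ?inE ?ji ?li.
case: (eqVneq l i) => [->|li]; first by rewrite ltnNge min_i.
case: (eqVneq j i) => [-> _|ji].
  by apply: max_g; have := fG l; rewrite !inE li Sl => /(_ isT)/andP[].
by apply: f_best; rewrite ?inE ?ji ?li.
Qed.

Definition value w (P : pred M) b (i j : 'I_n) : R :=
  \sum_(g | P g && (b g == j)) w i g.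

Lemma eq_value w (P Q : pred M) b i j :
  P =1 Q -> value w P b i j = value w Q b i j.
Proof. by move=> eqPQ; apply: eq_bigl => g; rewrite eqPQ. Qed.

(* The removed good need not belong to the bundle: if it does not, removing any
   other good instead is at least as favourable. *)
Definition EF1_on w (P : pred M) b : Prop :=
  forall i j, exists g,
    value w [predD1 P & g] b i j <= value w P b i i.

(** Categories are added one by one. After envy cycles are removed, enviers pick before those they
    envy. If [i] envies [j], then [i] prefers its own new good and the previously removed good still
    works; otherwise removing the new good of [j] suffices. *)
Lemma EF1_categories w (cat : M -> nat) s (x0 : M) :
    (0 < n)%N ->
    (forall i g, 0 <= w i g) ->
    (forall c, (c < s)%N -> #|[set g | cat g == c]| = n) ->
  exists2 b, EF1_on w (fun g => (cat g < s)%N) b &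
    forall c i, (c < s)%N -> #|[set g | (cat g == c) && (b g == i)]| = 1%N.
Proof.
move=> n_gt0 w_ge0; elim: s => [_|s IHs fiber].
  exists [ffun=> Ordinal n_gt0] => // i j.
  by exists x0; rewrite /value !big_pred0 // => g /=; rewrite andbF.
have [|b EF1_b one_b] := IHs; first by move=> c lt_cs; apply/fiber/ltnW.
pose D g := (cat g < s)%N.
have [p [le_p acyc]] := acyclic_envy (value w D b).
(* If [i] envies [j], whatever leads to [i] leads to [j], while [j] does not lead to [i]; so the
   rank of [i] is smaller. *)
pose rk i := #|[set j | connect (envy (value w D b) p) j i]|.
have rk_lt i j : envy (value w D b) p i j -> (rk i < rk j)%N.
  move=> e_ij; apply/proper_card/properP; split.
    by apply/subsetP=> k; rewrite !inE => /connect_trans; apply; apply: connect1.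
  by exists j; rewrite inE ?connect0 //; apply: acyc.
have [|f [fC f_inj f_best]] :=
    @picking w rk x0 [set: 'I_n] [set g | cat g == s].
  by rewrite fiber // cardsT card_ord.
have {fC} cat_f i : cat (f i) = s by have := fC i; rewrite !inE => /(_ isT)/eqP.
have {}f_inj : injective f by move=> i j; apply: f_inj; rewrite inE.
have f_onto g : cat g = s -> exists i, g = f i.
  move=> cat_g; suff: g \in f @: [set: 'I_n] by case/imsetP=> i _ ->; exists i.
  suff ->: f @: [set: 'I_n] = [set g | cat g == s] by rewrite inE cat_g.
  apply/eqP; rewrite eqEcard card_imset // cardsT card_ord fiber // leqnn andbT.
  by apply/subsetP=> _ /imsetP[i _ ->]; rewrite inE cat_f.
(* Agent [i] takes over the old bundle [p i], hence the inverse of [p]. The default [b g] never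
   occurs, as [f] exhausts category [s]. *)
pose b' := [ffun g => if cat g == s then odflt (b g) [pick i | f i == g]
                      else (p^-1)%g (b g)].
have b'f i : b' (f i) = i.
  rewrite ffunE cat_f eqxx; case: pickP => [j /eqP/f_inj //|/(_ i)].
  by rewrite eqxx.
have b'D g j : cat g != s -> (b' g == j) = (b g == p j).
  by move=> /negPf cat_g; rewrite ffunE cat_g -(inj_eq (@perm_inj _ p)) permKV.
have b'C g j : cat g = s -> (b' g == j) = (g == f j).
  by case/f_onto=> i ->; rewrite b'f (inj_eq f_inj).
have value_b' (Q : pred M) i j :
    value w [pred g | (cat g < s.+1)%N && Q g] b' i j
  = value w [pred g | D g && Q g] b i (p j) + (if Q (f j) then w i (f j) else 0).
  rewrite [RHS]addrC /value (bigID (fun g => cat g == s)) /=; congr (_ + _).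
    rewrite (eq_bigl (fun g => (g == f j) && Q g)) => [|g].
      by rewrite big_mkcondr big_pred1_eq.
    rewrite ltnS leq_eqVlt; have [cat_g|neq] := eqVneq (cat g) s.
      by rewrite b'C //= andbT andbC.
    by rewrite andbF; apply/esym; apply: contraNF neq => /andP[/eqP-> _]; rewrite cat_f.
  apply: eq_bigl => g; rewrite ltnS leq_eqVlt /D.
  have [->|neq] := eqVneq (cat g) s; first by rewrite ltnn andbF.
  by rewrite /= b'D // andbT.
have value_D Q i j : value w [pred g | D g && Q g] b i (p j) <= value w D b i (p j).
  rewrite /value [leRHS](bigID Q) /= (eq_bigl _ _ (fun g => andbAC (D g) _ _)).
  by rewrite lerDl sumr_ge0.
exists b' => [i j|c j].
  have val_i : value w (fun g => (cat g < s.+1)%N) b' i i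
             = value w D b i (p i) + w i (f i).
    rewrite (@eq_value _ _ ([pred g | (cat g < s.+1)%N && predT g])) => [|g].
      rewrite value_b'; congr (_ + _).
      by apply: eq_value => g; rewrite /= andbT.
    by rewrite /= andbT.
  rewrite val_i.
  have val_j g : value w [predD1 (fun g => (cat g < s.+1)%N) & g] b' i j
    = value w [predD1 D & g] b i (p j) + (if f j != g then w i (f j) else 0).
    rewrite (@eq_value _ _ ([pred h | (cat h < s.+1)%N && predC1 g h])) => [|h].
      rewrite value_b'; congr (_ + _).
      by apply: eq_value => h; rewrite /= andbC.
    by rewrite /= andbC.
  have [e_ij | not_e] := boolP (envy (value w D b) p i j).
    have [g le_g] := EF1_b i (p j); exists g; rewrite val_j; apply: lerD.
      exact: le_trans le_g (le_p i).
    case: ifP => _; rewrite ?w_ge0 //.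
    by apply: f_best; rewrite ?inE ?rk_lt.
  exists (f j); rewrite val_j eqxx addr0.
  rewrite (@eq_value _ _ ([pred g | D g && predC1 (f j) g])) => [|g]; last first.
    by rewrite /= andbC.
  apply: le_trans (value_D _ _ _) _; move: not_e; rewrite /= -leNgt => le_j.
  by apply: le_trans le_j _; rewrite lerDl.
rewrite ltnS leq_eqVlt => /orP[/eqP->|lt_cs].
  rewrite -(cards1 (f j)); apply: eq_card => g; rewrite !inE.
  have [cat_g|neq] := eqVneq (cat g) s; first by rewrite b'C.
  by apply/esym; apply: contraNF neq => /eqP->; rewrite cat_f.
rewrite -(one_b c (p j) lt_cs); apply: eq_card => g; rewrite !inE.
by case: eqP => // cat_g; rewrite b'D // cat_g neq_ltn lt_cs.
Qed.

End RoundRobin.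

(** * Pure and mixed categories *)

Lemma divn_eq_inj d a1 a2 t1 t2 : (t1 < d)%N -> (t2 < d)%N ->
  (a1 * d + t1 = a2 * d + t2)%N -> a1 = a2 /\ t1 = t2.
Proof.
move=> lt1 lt2 eq12; have d_gt0 : (0 < d)%N by apply: leq_ltn_trans lt1.
have := congr1 (divn^~ d) eq12; have := congr1 (modn^~ d) eq12.
by rewrite !modnMDl !divnMDl // !modn_small // !divn_small // !addn0.
Qed.

Lemma card_fibers (M J : finType) (f : M -> J) (P : pred M) :
  #|[set g | P g]| = (\sum_j #|[set g | P g && (f g == j)]|)%N.
Proof.
rewrite -sum1_card (partition_big f predT) //=; apply: eq_bigr => j _.
by rewrite -sum1_card; apply: eq_bigl => g; rewrite !inE.
Qed.

Section Categories.

Context {n : nat} {M : finType}.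
Implicit Types (a b : {ffun M -> 'I_n}).

(** Residues modulo [n] show that a block has at most [n] goods; the [s] blocks have [n * s] in
    total, so all are full. *)
Lemma card_fiber_divn (N : M -> nat) s c :
    injective N -> (forall g, (N g < n * s)%N) -> #|M| = (n * s)%N ->
  (c < s)%N -> #|[set g | N g %/ n == c]%N| = n.
Proof.
move=> N_inj N_lt cardM lt_cs.
have [n0 | n_gt0] := posnP n.
  by apply/eqP; rewrite [X in _ == X]n0 -leqn0 -(mul0n s) -n0 -cardM max_card.
have C_lt g : (N g %/ n < s)%N by rewrite ltn_divLR // mulnC.
pose C g := Ordinal (C_lt g).
have le_n d : (#|[set g | C g == d]| <= n)%N.
  rewrite -[X in (_ <= X)%N](card_ord n).
  pose f g := Ordinal (ltn_pmod (N g) n_gt0).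
  rewrite -(card_in_imset (f := f)) ?max_card // => g h.
  rewrite !inE => /eqP Cg /eqP Ch /(congr1 val) /= eq_mod.
  apply: N_inj; rewrite (divn_eq (N g) n) (divn_eq (N h) n) eq_mod.
  by have /(congr1 val) /= -> : C g = C h by rewrite Cg.
have := leqif_sum (fun d (_ : true) => leqif_eq (le_n d)).
have -> : (\sum_d #|[set g | C g == d]| = #|M|)%N.
  by rewrite -cardsT (card_fibers C predT).
rewrite big_const_ord iter_addn_0 cardM mulnC => /leqif_refl.
move=> /forallP/(_ (Ordinal lt_cs))/eqP eq_n; rewrite -[RHS]eq_n.
by apply: eq_card => g; rewrite !inE.
Qed.

Lemma exists_categories a s q r :
    s = (q * n + r)%N -> (forall i, #|[set g | a g == i]| = s) ->
  exists cat : M -> nat,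
    [/\ forall g, (cat g < s)%N,
        forall c, (c < s)%N -> #|[set g | cat g == c]| = n,
        forall g, (cat g < n * q)%N -> (cat g %/ q)%N = a g
      & forall g h, (n * q <= cat g)%N -> (n * q <= cat h)%N ->
          (a g < a h)%N -> (cat g <= cat h)%N].
Proof.
move=> def_s card_a.
pose t g := index g (enum [set h | a h == a g]).
have t_lt g : (t g < s)%N.
  by rewrite -(card_a (a g)) cardE index_mem mem_enum inE.
have t_inj g h : a g = a h -> t g = t h -> g = h.
  by move=> eq_a; rewrite /t eq_a; apply: (index_inj g); rewrite mem_enum inE ?eq_a.
(* The first [q * n] goods of every bundle are numbered first, owner by owner, then the [r]
   leftovers of every bundle, again owner by owner. Blocks of [n] numbers below [n * (q * n)] thus
   never mix owners. *)
pose N g := if (t g < q * n)%N then (a g * (q * n) + t g)%N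
            else (n * (q * n) + (a g * r + (t g - q * n)))%N.
have n_gt0 (g : M) : (0 < n)%N by apply: leq_ltn_trans (ltn_ord (a g)).
have le_a d g : ((a g).+1 * d <= n * d)%N by rewrite leq_mul2r ltn_ord orbT.
have N_lt g : (N g < n * s)%N.
  rewrite /N; have := le_a (q * n)%N g; have := le_a r g; have := t_lt g.
  by rewrite def_s !mulSn mulnDr; case: (ltnP (t g) (q * n)); lia.
have N_inj : injective N.
  move=> g h; rewrite /N; have := le_a (q * n)%N g; have := le_a (q * n)%N h.
  have := t_lt g; have := t_lt h; rewrite def_s !mulSn.
  case: (ltnP (t g) (q * n)) => tg; case: (ltnP (t h) (q * n)) => th; try lia.
    by move=> _ _ _ _ /divn_eq_inj[] // /val_inj/t_inj.
  move=> th_lt tg_lt _ _ /addnI/divn_eq_inj[]; try lia.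
  by move=> /val_inj eq_a eq_t; apply: t_inj => //; lia.
have cardM : #|M| = (n * s)%N.
  rewrite -cardsT (card_fibers a predT) /= (eq_bigr (fun=> s)) => [|i _] //.
  by rewrite big_const_ord iter_addn_0 mulnC.
exists (fun g => N g %/ n)%N; split.
- by move=> g; rewrite ltn_divLR ?(n_gt0 g) // mulnC.
- by move=> c; apply: card_fiber_divn.
- move=> g; have ngt0 := n_gt0 g; rewrite ltn_divLR // /N; have := le_a (q * n)%N g; rewrite mulSn.
  case: (ltnP (t g) (q * n)) => [tg _ _|]; last by lia.
  have q_gt0 : (0 < q)%N by case: (q) tg.
  by rewrite mulnA divnMDl // divnMDl // (divn_small (m := _ %/ _)) ?addn0 // ltn_divLR.
move=> g h; have ngt0 := n_gt0 g; rewrite ![(n * q <= _)%N]leq_divRL // /N.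
have := le_a (q * n)%N g; have := le_a (q * n)%N h; rewrite !mulSn.
have := t_lt g; rewrite def_s; case: (ltnP (t g) (q * n)) => tg;
  case: (ltnP (t h) (q * n)) => th; try lia.
move=> tg_lt _ _ _ _ lt_a; apply: leq_div2r; rewrite leq_add2l.
have: ((a g).+1 * r <= a h * r)%N by rewrite leq_mul2r lt_a orbT.
by rewrite mulSn; lia.
Qed.

End Categories.

(** * Cost of the pure and of the mixed goods *)

Lemma uniq_map_inj (T1 T2 : eqType) (f : T1 -> T2) (s : seq T1) :
  uniq (map f s) -> {in s &, injective f}.
Proof.
elim: s => //= x s IHs /andP[fx_s /IHs inj_s] y z.
rewrite !inE => /predU1P[->|sy] /predU1P[->|sz] // eq_f; last exact: inj_s.
  by rewrite eq_f map_f in fx_s.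
by rewrite -eq_f map_f in fx_s.
Qed.

Lemma card_bigcup_cond (I M : finType) (D : I -> {set M}) (P : pred M) :
    (forall i j, i != j -> [disjoint D i & D j]) ->
  #|[set g in \bigcup_i D i | P g]| = (\sum_i #|[set g in D i | P g]|)%N.
Proof.
move=> disjD; have card_cond (E : {set M}) :
    #|[set g in E | P g]| = (\sum_(g in E) P g)%N.
  rewrite -sum1_card big_mkcond [RHS]big_mkcond; apply: eq_bigr => g _.
  by rewrite inE; case: (g \in E); case: (P g).
rewrite card_cond partition_disjoint_bigcup //; apply: eq_bigr => i _.
by rewrite card_cond.
Qed.

Section ManyAgentsCost.

Context {n : nat} {M : finType}.
Implicit Types (a b : {ffun M -> 'I_n}).

(** Each of the [q] pure categories of [i] gives one good to [j], so exactly [q] goods go from [i]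
    to [j] for all [i] and [j]. This is symmetric, with [q * (n * n.-1)] goods changing owner. *)
Lemma fixable_pure a b (cat : M -> nat) s q :
    (n * q <= s)%N ->
    (forall c i, (c < s)%N -> #|[set g | (cat g == c) && (b g == i)]| = 1%N) ->
    (forall g, (cat g < n * q)%N -> (cat g %/ q)%N = a g) ->
    let T := [set g | (cat g < n * q)%N] in
  balanced_on a b T /\ fixable a b T (q * (n * n.-1))./2.
Proof.
move=> le_s one_b pure T.
have card_T i j : #|[set g in T | (a g == i) && (b g == j)]| = q.
  have cat_lt k : (k < q)%N -> (i * q + k < n * q)%N.
    move=> lt_kq; apply: (@leq_trans (i.+1 * q)%N).
      by rewrite mulSn addnC ltn_add2r.
    by rewrite leq_mul2r ltn_ord orbT.
  have /fin_all_exists[x Px] (k : 'I_q) :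
      exists g, cat g = (i * q + k)%N /\ b g = j.
    have /card_gt0P[g] : (0 < #|[set g | (cat g == i * q + k)%N && (b g == j)]|)%N.
      by rewrite one_b // (leq_trans (cat_lt _ (ltn_ord k))).
    by rewrite inE => /andP[/eqP ? /eqP ?]; exists g.
  have x_inj : injective x.
    by move=> k l eq_x; apply/val_inj/eqP; rewrite -(eqn_add2l (i * q)) /=;
      have [<- _] := Px k; have [<- _] := Px l; rewrite eq_x.
  rewrite -[RHS](card_ord q) -cardsT -(card_imset _ x_inj).
  apply: eq_card => g; apply/idP/imsetP=> [|[k _ ->]]; last first.
    have [cat_x b_x] := Px k; have q_gt0 : (0 < q)%N by apply: leq_ltn_trans (ltn_ord k).
    have lt_x : (cat (x k) < n * q)%N by rewrite cat_x cat_lt.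
    rewrite !inE lt_x b_x eqxx andbT /=.
    by rewrite -val_eqE /= -pure // cat_x divnMDl // divn_small ?addn0.
  rewrite !inE => /and3P[lt_g /eqP a_g /eqP b_g].
  have q_gt0 : (0 < q)%N by case: (q) lt_g => //; rewrite muln0.
  pose k := Ordinal (ltn_pmod (cat g) q_gt0); exists k => //.
  have [cat_x b_x] := Px k.
  have {}cat_x : cat (x k) = cat g.
    by rewrite cat_x [RHS](divn_eq _ q) pure // a_g.
  apply/eqP; rewrite -in_set1; suff <-: [set h | (cat h == cat g) && (b h == j)] = [set x k].
    by rewrite inE eqxx b_g eqxx.
  apply/esym/eqP; rewrite eqEcard sub1set inE cat_x b_x !eqxx cards1.
  by rewrite one_b // (leq_trans lt_g).
split=> [i|].
  rewrite (card_fibers b) [RHS](card_fibers a); apply: eq_bigr => j _.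
  transitivity q; last first.
    by rewrite -(card_T j i); apply: eq_card => g; rewrite !inE andbA andbAC.
  by rewrite -(card_T i j); apply: eq_card => g; rewrite !inE andbA.
suff <-: #|[set g in T | a g != b g]| = (q * (n * n.-1))%N.
  by apply: fixable_symmetric => i j; rewrite !card_T.
rewrite (card_fibers a) (eq_bigr (fun=> n.-1 * q)%N) => [|i _].
  by rewrite big_const_ord iter_addn_0 mulnC mulnA [RHS]mulnC.
rewrite (card_fibers b) (bigD1 i) //= [X in (X + _)%N](_ : _ = 0)%N; last first.
  apply/eqP; rewrite cards_eq0; apply/eqP/setP=> g; rewrite !inE.
  by apply/negP=> /andP[/andP[/andP[_ /eqP ne] /eqP a_g] /eqP b_g]; case: ne; rewrite a_g.
rewrite add0n (eq_bigr (fun=> q)) => [|j ne_ji].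
  by rewrite sum_nat_const cardC1 card_ord.
rewrite -(card_T i j); apply: eq_card => g; rewrite !inE.
have [-> | _] := eqVneq (a g) i; last by rewrite !andbF.
have [-> | _] := eqVneq (b g) j; last by rewrite !andbF.
by rewrite eq_sym ne_ji !andbT.
Qed.

Lemma trails_mixed a b (cat : M -> nat) s d (T : {set M}) :
    (d < s)%N -> T = [set g | (d <= cat g)%N] ->
    (forall g, (cat g < s)%N) ->
    (forall c, (c < s)%N -> #|[set g | cat g == c]| = n) ->
    (forall c i, (c < s)%N -> #|[set g | (cat g == c) && (b g == i)]| = 1%N) ->
    (forall g h, (d <= cat g)%N -> (d <= cat h)%N ->
       (a g < a h)%N -> (cat g <= cat h)%N) ->
    (s - d <= n)%N -> (1 < n)%N ->
    balanced_on a b T ->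
  fixable a b T ((s - d) * (n - 2) + 1).
Proof.
move=> lt_ds defT cat_lt fiber one_b mono le_n n_gt1 balT.
set r := (s - d)%N.
(* In [b] every agent owns a good of each category, so a cycle exists inside each mixed one. *)
have /fin_all_exists[c Pc] (k : 'I_r) : exists c : seq M,
    [/\ c != [::], {in c, forall g, cat g = (d + k)%N}, uniq (map a c)
      & cycle (trail a b) c].
  have lt_k : (d + k < s)%N by rewrite -ltn_subRL ltn_ord.
  have [|g _|c [c_n0 sub_c uniq_c cyc_c]] :=
    @exists_cycle n M a b [set g | cat g == (d + k)%N].
  - by rewrite -card_gt0 fiber //; lia.
  - have /card_gt0P[h] : (0 < #|[set h | (cat h == (d + k)%N) && (b h == a g)]|)%N.
      by rewrite one_b.
    by rewrite inE => /andP[cat_h /eqP b_h]; exists h; rewrite ?inE.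
  by exists c; split=> // g /sub_c; rewrite inE => /eqP.
pose C k := [set g in c k]; pose U := \bigcup_k C k.
have catC k g : g \in C k -> cat g = (d + k)%N.
  by rewrite inE; have [_ + _ _] := Pc k; apply.
have disjC k l : k != l -> [disjoint C k & C l].
  move=> ne_kl; rewrite -setI_eq0; apply/eqP/setP=> g; rewrite inE [RHS]inE.
  apply: contraNF ne_kl => /andP[/catC cat_k /catC].
  by rewrite cat_k => /addnI/val_inj->.
have tr_U : trails a b U r.
  rewrite -[r]card_ord; apply: trails_bigcup => // k.
  by have [c_n0 _ /map_uniq uniq_c cyc_c] := Pc k; apply: trails_cycle.
have sUT : U \subset T.
  by apply/bigcupsP=> k _; apply/subsetP=> g /catC cat_g; rewrite defT inE cat_g leq_addr.
have balU : balanced_on a b U.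
  move=> i; rewrite !card_bigcup_cond //; apply: eq_bigr => k _.
  by have [_ _ /map_uniq uniq_c cyc_c] := Pc k; apply: balanced_cycle.
have cardT : #|T| = (n * r)%N.
  rewrite defT (card_fibers (fun g => Ordinal (cat_lt g))).
  rewrite (eq_bigr (fun c : 'I_s => if (d <= c)%N then n else 0%N)) => [|e _].
    rewrite -big_mkcond -(big_mkord (fun e => d <= e)%N (fun=> n)).
    rewrite -(@big_nat_widenl _ _ _ d 0 s predT) // sum_nat_const_nat.
    by rewrite mulnC.
  case: ifP => le_de.
    rewrite -[RHS](fiber e) //; apply: eq_card => g; rewrite !inE -val_eqE /=.
    by case: eqP => [->|]; rewrite ?le_de ?andbF.
  apply/eqP; rewrite cards_eq0; apply/eqP/setP=> g; rewrite !inE -val_eqE /=.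
  by case: eqP => [->|]; rewrite ?le_de ?andbF.
have cardU : (#|U| <= n + r - 1)%N.
  (* [cat] and [a] grow together on mixed goods, so their sum determines both,
     and each chosen cycle visits an agent at most once. *)
  have def_nr : (n + r - 1 = (n + r - 2).+1)%N by lia.
  pose f g : 'I_(n + r - 2).+1 := inord (cat g - d + a g).
  have f_val g : f g = (cat g - d + a g)%N :> nat.
    by rewrite inordK //; have := cat_lt g; have := ltn_ord (a g); lia.
  rewrite def_nr -[X in (_ <= X)%N]card_ord -(card_in_imset (f := f)) ?max_card //.
  move=> g h Ug Uh /(congr1 val); rewrite /= !f_val => eq_gh.
  have le_d x : x \in U -> (d <= cat x)%N.
    by move/(subsetP sUT); rewrite defT inE.
  have eq_a : a g = a h.
    apply/val_inj/eqP; rewrite eqn_leq; have := mono g h (le_d _ Ug) (le_d _ Uh).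
    have := mono h g (le_d _ Uh) (le_d _ Ug); have := le_d _ Ug; have := le_d _ Uh.
    by move: eq_gh => /=; lia.
  have /bigcupP[k _ Cg] := Ug; have /bigcupP[l _ Ch] := Uh.
  have eq_kl : k = l.
    apply: val_inj => /=; move: eq_gh; rewrite eq_a (catC _ _ Cg) (catC _ _ Ch).
    by rewrite !addKn => /addIn.
  have [_ _ uniq_c _] := Pc k; move: Cg Ch; rewrite -eq_kl !inE => Cg Ch.
  exact: (uniq_map_inj uniq_c).
have [m tr_D le_D] := trails_balanced (balancedD sUT balT balU).
have: trails a b (U :|: T :\: U) (r + m).
  by apply: trailsU => //; rewrite -setI_eq0 setIDA setIC -setIDA setDv setI0.
rewrite -{1}(setIidPr sUT) setID => -[k le_k fix_k].
rewrite cardsDS // cardT in le_D; rewrite cardT in le_k.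
have r_gt0 : (0 < r)%N by rewrite subn_gt0.
(* At least [n * r - (n + r - 1) = n * (r - 2) + (n - r + 1)] goods remain when [r] is at least 2,
   more than [r - 2] cycles can hold because [r <= n]. *)
have ge_m : (r - 1 <= m)%N.
  rewrite leqNgt; apply/negP=> lt_m.
  have : (n * m <= n * (r - 2))%N by rewrite leq_mul2l; lia.
  by rewrite mulnBr; nia.
by apply: fixable_leq fix_k; rewrite mulnBr [(r * n)%N]mulnC; nia.
Qed.

End ManyAgentsCost.

(** * Two agents *)

Section ConsecutivePairs.

Context {T : eqType}.
Implicit Types (c : pred T) (l : seq T).

(** The pairs are disjoint: first with second, third with fourth, and so on. A leftover last entry
    is unconstrained. *)
Fixpoint splits c l : bool :=
  if l is x :: y :: l' then (c x != c y) && splits c l' else true.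

(** The matching behind [splits]; unmatched elements are their own mates. *)
Fixpoint mate l x : T :=
  if l is y :: z :: l' then
    if x == y then z else if x == z then y else mate l' x
  else x.

Lemma pair_ind (P : seq T -> Prop) :
    P [::] -> (forall x, P [:: x]) -> (forall x y l, P l -> P [:: x, y & l]) ->
  forall l, P l.
Proof.
move=> P0 P1 P2; fix IH 1 => -[//|x [//|y l]].
by apply: P2; apply: IH.
Qed.

Lemma splits_predC c l : splits (predC c) l = splits c l.
Proof.
elim/pair_ind: l => //= x y l ->.
by case: (c x); case: (c y).
Qed.

Lemma splits_catl c l1 l2 : splits c (l1 ++ l2) -> splits c l1.
Proof. by elim/pair_ind: l1 => //= x y l1 IHl /andP[-> /IHl]. Qed.

Lemma splits_catr c l1 l2 :
  ~~ odd (size l1) -> splits c (l1 ++ l2) -> splits c l2.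
Proof.
by elim/pair_ind: l1 => //= x y l1 IHl; rewrite negbK => /IHl{}IHl /andP[_].
Qed.

Lemma count_splits c l :
  ~~ odd (size l) -> splits c l -> count c l = (size l)./2.
Proof.
elim/pair_ind: l => //= x y l IHl; rewrite negbK => /IHl{}IHl /andP[ne /IHl->].
by rewrite addnA; move: ne; case: (c x); case: (c y).
Qed.

Lemma mateP l x : uniq l -> ~~ odd (size l) -> x \in l ->
  [/\ mate l x \in l, mate l x != x & mate l (mate l x) = x].
Proof.
elim/pair_ind: l => //= y z l IHl /and3P[]; rewrite inE negb_or.
move=> /andP[ne_yz l_y] l_z uniq_l; rewrite negbK => even_l.
rewrite !inE; case: eqVneq => [->|ne_xy] /=.
  by rewrite [z == y]eq_sym (negPf ne_yz) !eqxx orbT.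
case: eqVneq => [->|ne_xz] /= l_x; first by rewrite !eqxx ne_yz.
have [l_m ne_m mm] := IHl uniq_l even_l l_x.
rewrite l_m !orbT ne_m mm; split=> //.
by case: eqP l_y => [<-|_ _]; [rewrite l_m | case: eqP l_z => // <-; rewrite l_m].
Qed.

Lemma splits_mate c l :
  uniq l -> {in l, forall x, c (mate l x) != c x} -> splits c l.
Proof.
elim/pair_ind: l => //= y z l IHl /and3P[]; rewrite inE negb_or.
move=> /andP[ne_yz l_y] l_z uniq_l c_mate; apply/andP; split.
  by have := c_mate y; rewrite mem_head eqxx eq_sym; apply.
apply: IHl => // x l_x; have := c_mate x; rewrite !inE l_x !orbT => /(_ isT).
by case: (x =P y) l_y => [<-|_ _]; [rewrite l_x | case: (x =P z) l_z => // <-; rewrite l_x].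
Qed.

End ConsecutivePairs.

(* An orbit of [Q \o P] never contains both [x] and [P x], so [P] and [Q]
   exchange the two orbits that form each component. *)
Lemma two_coloring (T : finType) (P Q : T -> T) :
    involutive P -> involutive Q -> (forall x, P x != x) -> (forall x, Q x != x) ->
  exists c : pred T, forall x, c (P x) != c x /\ c (Q x) != c x.
Proof.
move=> PK QK Pne Qne; pose f x := Q (P x).
have f_inj : injective f by move=> x y; rewrite /f => /(inv_inj QK)/(inv_inj PK).
(* If [k + 2] steps led from [x] to [P x], then [k] steps would lead from [f x] to [P (f x)]. For
   [k] equal to 0 or 1, [P] or [Q] would have a fixed point. *)
have orb k x : iter k f x != P x.
  elim/ltn_ind: k x => -[|[|k]] IHk x; first by rewrite eq_sym Pne.
    exact: Qne.
  apply: contra (IHk k _ (f x)) => [|//]; rewrite iterS iterSr => /eqP eq_k.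
  by apply/eqP; apply: (inv_inj PK); apply: (inv_inj QK); rewrite -/(f _) eq_k /f PK QK.
pose r x := enum_rank (froot f x).
have r_eq x y : (r x == r y) = fconnect f x y.
  by rewrite (inj_eq enum_rank_inj) root_connect //; apply: fconnect_sym.
have r_P x : r x != r (P x).
  by rewrite r_eq; apply/negP=> /iter_findex eq_P;
    have := orb (findex f x (P x)) x; rewrite eq_P eqxx.
(* Of the two orbits of a component, the one whose root has the smaller rank gets the colour. *)
pose c x := (r x < r (P x))%N.
have c_P x : c (P x) != c x.
  by rewrite /c PK; have := r_P x; rewrite -val_eqE /=; case: ltngtP.
exists c => x; split=> //.
have rQ : r (Q x) = r (P x).
  by apply/esym/eqP; rewrite r_eq -{2}(PK x); apply: fconnect1.
have rPQ : r (P (Q x)) = r x.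
  apply/eqP; rewrite r_eq; have {2}<- : f (P (Q x)) = x by rewrite /f PK QK.
  exact: fconnect1.
by have := c_P x; rewrite /c rQ rPQ PK.
Qed.

Lemma splits_two_lists (T : finType) (l1 l2 : seq T) :
    uniq l1 -> uniq l2 -> ~~ odd #|T| -> l1 =i T -> l2 =i T ->
  exists2 c : pred T, splits c l1 & splits c l2.
Proof.
move=> uniq1 uniq2 even_T in1 in2.
have even l : uniq l -> l =i T -> ~~ odd (size l).
  by move=> /card_uniqP <- /eq_card->.
have all_in (l : seq T) : l =i T -> forall x, x \in l by move=> eq_l x; rewrite eq_l.
have m1 x := mateP uniq1 (even _ uniq1 in1) (all_in _ in1 x).
have m2 x := mateP uniq2 (even _ uniq2 in2) (all_in _ in2 x).
have [||||c c_ne] := @two_coloring T (mate l1) (mate l2).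
- by move=> x; case: (m1 x).
- by move=> x; case: (m2 x).
- by move=> x; case: (m1 x).
- by move=> x; case: (m2 x).
by exists c; apply: splits_mate => // x _; case: (c_ne x).
Qed.

Section Alternating.

Context {R : realType} {T : eqType}.
Implicit Types (F : T -> R) (c : pred T) (l : seq T).

(** When [c] marks the bundle of the other agent, this is the envy arising from the goods of [l]. *)
Definition excess F c l : R := \sum_(x <- l) (if c x then F x else - F x).

(** At worst [c] takes the better good of every pair; the differences then telescope below [m]. In
    the induction, the second good of a pair bounds what follows. *)
Lemma excess_le F c l m :
    (forall x, 0 <= F x) -> splits c l -> path (fun u v => v <= u) m (map F l) ->
    0 <= m ->
  excess F c l <= m.
Proof.
move=> F_ge0; rewrite /excess.
elim/(@pair_ind T): l m => [|x|x y l IHl] m /=; first by rewrite big_nil.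
  rewrite big_seq1 => _ /andP[le_x _] m_ge0; case: ifP => // _.
  by apply: le_trans m_ge0; rewrite oppr_le0.
move=> /andP[ne split_l] /and3P[le_x le_y path_l] m_ge0.
have := IHl _ split_l path_l (F_ge0 y); rewrite !big_cons.
by move: ne; case: (c x); case: (c y) => // _; lra.
Qed.

(** In [x0 :: t], the favourite [x0] is kept and outweighs any excess of [t]. In [l], the marked
    good of the first pair is removed, and the rest exceeds by at most the second good. If [l] is a
    single good, it is marked, being paired with [x0]. *)
Lemma excess_EF1 F c x0 t l :
    (forall x, 0 <= F x) -> ~~ c x0 -> odd (size l) ->
    splits c t -> splits c (l ++ [:: x0]) ->
    sorted (fun u v => v <= u) (map F (x0 :: t)) ->
    sorted (fun u v => v <= u) (map F l) ->
  exists2 g, c g & excess F c (x0 :: t) + excess F c l <= F g.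
Proof.
move=> F_ge0 cx0 odd_l split_t split_l path_t path_l.
have own : excess F c (x0 :: t) <= 0.
  have := excess_le F_ge0 split_t path_t (F_ge0 x0).
  by rewrite /excess big_cons (negPf cx0); lra.
suff [g cg le_g] : exists2 g, c g & excess F c l <= F g by exists g => //; lra.
case: l odd_l split_l path_l => [|z [|y l]] //= odd_l.
  rewrite andbT (negPf cx0) => cz _; exists z; first by move: cz; case: (c z).
  by rewrite /excess big_seq1; case: ifP => // _; have := F_ge0 z; lra.
move=> /andP[ne /splits_catl split_l] /andP[le_yz path_l].
have le_l := excess_le F_ge0 split_l path_l (F_ge0 y).
rewrite /excess in le_l *; move: ne.
case cz: (c z); case cy: (c y) => // _; [exists z | exists y] => //;
  by rewrite !big_cons cz cy; lra.
Qed.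

End Alternating.

Section TwoAgents.

Context {R : realType} {M : finType}.
Implicit Types (a b : {ffun M -> 'I_2}) (w : 'I_2 -> M -> R).

Lemma sorted_goods (F : M -> R) (A : {set M}) :
  exists l, [/\ uniq l, l =i A, size l = #|A|
              & sorted (fun u v => v <= u) (map F l)].
Proof.
pose e := relpre F (fun u v : R => v <= u).
exists (sort e (enum A)); split.
- by rewrite sort_uniq enum_uniq.
- by move=> x; rewrite mem_sort mem_enum.
- by rewrite size_sort -cardE.
by rewrite sorted_map; apply: sort_sorted => x y; rewrite /e /= le_total.
Qed.

Lemma excess_value w b c i j g :
    (forall h, (b h == j) = c h) -> (forall h, (b h == i) = ~~ c h) -> c g ->
    \sum_h (if c h then w i h else - w i h) <= w i g ->
  value w [predD1 predT & g] b i j <= value w predT b i i.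
Proof.
move=> bj bi cg; rewrite (bigID c) /= (bigD1 g) //= cg -addrA gerDl.
rewrite [X in _ + X](eq_bigr (fun h => - w i h)) => [|h /negPf-> //].
rewrite sumrN subr_le0; congr (_ <= _); rewrite /value.
  rewrite (eq_bigr (w i)) => [|h /andP[-> _] //].
  by apply: eq_bigl => h; rewrite /= bj andbT andbC.
by apply: eq_bigl => h; rewrite bi.
Qed.

Lemma two_agents a w q :
    (forall i g, 0 <= w i g) ->
    (forall i, #|[set g | a g == i]| = q.*2.+1) ->
  exists2 b, EF1_on w predT b & fixable a b [set: M] q.
Proof.
move=> w_ge0 card_a.
pose i0 : 'I_2 := ord0; pose i1 : 'I_2 := ord_max.
have I2 i : i = i0 \/ i = i1.
  by case: i => -[|[|]] // ?; [left | right]; apply: val_inj.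
have ord_a g : (a g == i1) = (a g != i0) by case: (I2 (a g)) => ->.
have lists i j : i != j -> exists x t l,
    [/\ uniq (x :: t ++ l), x :: t =i [set g | a g == i],
        l =i [set g | a g == j], size t = q.*2 & size l = q.*2.+1]
    /\ sorted (fun u v => v <= u) (map (w i) (x :: t))
       && sorted (fun u v => v <= u) (map (w i) l).
  move=> ne_ij; have [[|x t] [uniq_t in_t]] := sorted_goods (w i) [set g | a g == i].
    by rewrite card_a.
  rewrite card_a => -[size_t] sort_t.
  have [l [uniq_l in_l]] := sorted_goods (w i) [set g | a g == j].
  rewrite card_a => size_l sort_l.
  exists x, t, l; rewrite sort_t sort_l; split=> //; split=> //.
  rewrite -cat_cons cat_uniq uniq_t uniq_l andbT; apply/hasPn=> g.
  by rewrite in_l in_t !inE => /eqP->; rewrite eq_sym.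
have [x0 [t0 [l0 [[u0 it0 il0 st0 sl0] /andP[sort_t0 sort_l0]]]]] := lists i0 i1 isT.
have [x1 [t1 [l1 [[u1 it1 il1 st1 sl1] /andP[sort_t1 sort_l1]]]]] := lists i1 i0 isT.
have perm_L (x : M) t l : perm_eq (t ++ l ++ [:: x]) (x :: t ++ l).
  by rewrite catA perm_catC.
have cardM : #|M| = q.*2.+1.*2.
  rewrite -cardsT (card_fibers a predT) /= (eq_bigr (fun=> q.*2.+1)) => [|i _] //.
  by rewrite big_const_ord iter_addn_0 muln2.
have all0 : x0 :: t0 ++ l0 =i M.
  move=> g; rewrite -cat_cons mem_cat it0 il0 !inE ord_a.
  by case: (a g == i0).
have all1 : x1 :: t1 ++ l1 =i M.
  move=> g; rewrite -cat_cons mem_cat it1 il1 !inE ord_a.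
  by case: (a g == i0).
(* Consecutive pairs of these lists match the favourite own good with the least
   valued good of the other agent. *)
have [c [cx0 sc0 sc1]] : exists c : pred M, [/\ ~~ c x0,
    splits c (t0 ++ l0 ++ [:: x0]) & splits c (t1 ++ l1 ++ [:: x1])].
  have [|||||c sc0 sc1] :=
    @splits_two_lists M (t0 ++ l0 ++ [:: x0]) (t1 ++ l1 ++ [:: x1]).
  - by rewrite (perm_uniq (perm_L _ _ _)).
  - by rewrite (perm_uniq (perm_L _ _ _)).
  - by rewrite cardM odd_double.
  - by move=> g; rewrite (perm_mem (perm_L _ _ _)) all0.
  - by move=> g; rewrite (perm_mem (perm_L _ _ _)) all1.
  (* Complementing a colouring preserves the splitting, so agent [i0] may be assumed to keep
     [x0]. *)
  case cx0: (c x0); last by exists c; rewrite cx0.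
  by exists (predC c); rewrite !splits_predC /= cx0.
have even_t (t : seq M) : size t = q.*2 -> ~~ odd (size t).
  by move->; rewrite odd_double.
have count_list (p : pred M) (A : {set M}) l :
    uniq l -> l =i A -> #|[set g in A | p g]| = count p l.
  move=> uniq_l in_l; rewrite -(card_set_seq _ uniq_l); apply: eq_card => g.
  by rewrite !inE in_l.
have [ut0 ul0] : uniq (x0 :: t0) /\ uniq l0.
  by move: u0; rewrite -cat_cons cat_uniq => /and3P[].
have [ut1 ul1] : uniq (x1 :: t1) /\ uniq l1.
  by move: u1; rewrite -cat_cons cat_uniq => /and3P[].
have split_l0 := splits_catr (even_t _ st0) sc0.
have split_l1 := splits_catr (even_t _ st1) sc1.
have split_t0 := splits_catl sc0; have split_t1 := splits_catl sc1.
have count0 : #|[set g in [set g | a g == i0] | c g]| = q.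
  rewrite (count_list _ _ _ ut0 it0) /= (negPf cx0) add0n.
  by rewrite count_splits ?even_t // st0 doubleK.
(* Half of the [2q + 2] goods of [l1 ++ [:: x1]] are marked, but only [q] of those in [l1], which
   are the goods of [i0]. So [i1] keeps its favourite [x1] too. *)
have cx1 : c x1.
  have: count c (l1 ++ [:: x1]) = q.+1.
    by rewrite count_splits // size_cat sl1 addn1 /= ?odd_double // doubleK.
  rewrite count_cat -(count_list _ _ _ ul1 il1) count0 /= addn0.
  by rewrite -[q.+1]addn1 => /addnI; case: (c x1).
have count1 : #|[set g in [set g | a g == i1] | c g]| = q.+1.
  rewrite (count_list _ _ _ ut1 it1) /= cx1 add1n.
  by rewrite count_splits ?even_t // st1 doubleK.
pose b := [ffun g => if c g then i1 else i0].
have b1 g : (b g == i1) = c g by rewrite ffunE; case: (c g).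
have b0 g : (b g == i0) = ~~ c g by rewrite ffunE; case: (c g).
have total (d : pred M) i x t l : uniq (x :: t ++ l) -> x :: t ++ l =i M ->
    excess (w i) d (x :: t) + excess (w i) d l
  = \sum_h (if d h then w i h else - w i h).
  move=> uniq_L in_L; rewrite /excess -big_cat /= big_uniq //=.
  by apply: eq_bigl => h; rewrite in_L.
exists b.
  have self i : exists g, value w [predD1 predT & g] b i i <= value w predT b i i.
    exists x0; rewrite /value big_mkcond [leRHS]big_mkcond; apply: ler_sum => g _ /=.
    by case: (g != x0) => //=; case: ifP.
  move=> i j; case: (I2 i) (I2 j) => [->|->] [->|->] //.
    have [|g cg le_g] := excess_EF1 (w_ge0 i0) cx0 _ split_t0 split_l0 sort_t0 sort_l0.
      by rewrite sl0 /= odd_double.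
    by exists g; apply: (excess_value b1 b0 cg); rewrite -(total _ _ _ _ _ u0 all0).
  have [||||g cg le_g] :=
    @excess_EF1 _ _ (w i1) (predC c) x1 t1 l1 (w_ge0 i1) _ _ _ _ sort_t1 sort_l1.
  - by rewrite /= cx1.
  - by rewrite sl1 /= odd_double.
  - by rewrite splits_predC.
  - by rewrite splits_predC.
  exists g; apply: (excess_value (c := predC c)) => //; first by move=> h; rewrite b1 /= negbK.
  by rewrite -(total _ _ _ _ _ u1 all1).
(* Exactly [q] goods travel each way, so [q] exchanges of such pairs suffice. *)
have sym01 : #|[set g in [set: M] | (a g == i0) && (b g == i1)]| = q.
  by rewrite -[RHS]count0; apply: eq_card => g; rewrite !inE b1.
have sym10 : #|[set g in [set: M] | (a g == i1) && (b g == i0)]| = q.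
  have := cardsID [set g | c g] [set g | a g == i1].
  rewrite card_a [X in (X + _)%N](_ : _ = q.+1); last first.
    by rewrite -[RHS]count1; apply: eq_card => g; rewrite !inE.
  rewrite [X in (_ + X)%N](_ : _ = #|[set g in [set: M] | (a g == i1) && (b g == i0)]|).
    by rewrite -addnn -addSn => /addnI.
  by apply: eq_card => g; rewrite !inE b0 andbC.
rewrite -[q]doubleK -addnn -{1}sym01 -sym10.
suff <-: #|[set g in [set: M] | a g != b g]|
    = (#|[set g in [set: M] | (a g == i0) && (b g == i1)]|
    + #|[set g in [set: M] | (a g == i1) && (b g == i0)]|)%N.
  apply: fixable_symmetric => i j.
  by case: (I2 i) (I2 j) => [->|->] [->|->] //; rewrite sym01 sym10.
rewrite -(cardsID [set g | c g]); congr (_ + _)%N; apply: eq_card => g; rewrite !inE.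
  by rewrite b1; case: (boolP (c g)) => cg; rewrite ?andbF // !andbT ffunE cg ord_a negbK.
by rewrite b0 andbC; case: (boolP (c g)) => cg; rewrite ?andbF // !andbT ffunE (negPf cg) ord_a.
Qed.

End TwoAgents.

(** * From owner functions to the bounds on exchanges *)

Lemma EF1_bundles (R : realType) (n : nat) (M : finType)
    (u : 'I_n -> {set M} -> R) (b : {ffun M -> 'I_n}) :
    additive_utilities u -> EF1_on (fun i g => u i [set g]) predT b ->
  EF1 u (bundles b).
Proof.
move=> [u_ge0 u_sum] EF1_b i j _; rewrite /EF1_towards.
have val_b P k : value (fun i g => u i [set g]) P b i k
    = u i [set g in bundles b k | P g].
  by rewrite [RHS]u_sum; apply: eq_bigl => g; rewrite ffunE !inE andbC.
have [g] := EF1_b i j; rewrite !val_b => le_g.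
have own : [set h in bundles b i | predT h] = bundles b i.
  by apply/setP=> h; rewrite !inE andbT.
rewrite own in le_g.
have [-> | /set0Pn[h jh]] := eqVneq (bundles b j) set0; [by left | right].
have [jg | g_j] := boolP (g \in bundles b j).
  exists g => //; apply: le_trans le_g; rewrite le_eqVlt; apply/orP; left; apply/eqP.
  by congr (u i _); apply/setP=> x; rewrite !inE andbT andbC.
exists h => //; apply: le_trans le_g; rewrite u_sum [leRHS]u_sum.
rewrite big_mkcond [leRHS]big_mkcond; apply: ler_sum => x _.
rewrite !inE andbT; case: (eqVneq x h) => [->|_] /=.
  by case: ifP => // _; apply: u_ge0.
have [->|] := eqVneq x g; last by rewrite andbT.
by rewrite (negPf g_j).
Qed.

(** The argument of type [M] supplies a default good; it exists because [n * s] is positive. *)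
Lemma exchanges_suffice_fixable (R : realType) (n s k : nat) :
    (0 < n * s)%N ->
    (forall (M : finType) (w : 'I_n -> M -> R) (a : {ffun M -> 'I_n}),
      (forall i g, 0 <= w i g) -> (forall i, #|[set g | a g == i]| = s) -> M ->
      exists2 b, EF1_on w predT b & fixable a b [set: M] k) ->
  exchanges_suffice R n s k.
Proof.
move=> ns_gt0 fix_k M u A cardM add_u /allocation_bundles[a ->] bal_a.
have [|||b EF1_b /fixableT[p [path_p size_p last_p]]] :=
  fix_k M (fun i g => u i [set g]) a.
- by move=> i g; case: add_u => u_ge0 _; apply: u_ge0.
- by move=> i; rewrite -(bal_a i) ffunE.
- apply: (@xchoose M predT); rewrite -cardM in ns_gt0.
  by have /card_gt0P[x _] := ns_gt0; exists x.
exists p; split; rewrite ?last_p //; first exact: bundles_allocation.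
exact: EF1_bundles.
Qed.

Lemma many_agents (R : realType) (n : nat) (M : finType) (w : 'I_n -> M -> R)
    (a : {ffun M -> 'I_n}) (q r : nat) :
    (1 < n)%N -> (r < n)%N -> (forall i g, 0 <= w i g) ->
    (forall i, #|[set g | a g == i]| = q * n + r)%N -> M ->
  exists2 b, EF1_on w predT b & fixable a b [set: M]
    ((q * (n * n.-1))./2 + (if r == 0 then 0 else r * (n - 2) + 1))%N.
Proof.
move=> n_gt1 lt_rn w_ge0 card_a x0; set s := (q * n + r)%N in card_a.
have [cat [cat_lt fiber pure mono]] := exists_categories (erefl s) card_a.
have [b EF1_b one_b] := EF1_categories x0 (ltnW n_gt1) w_ge0 fiber.
exists b.
  move=> i j; have [g le_g] := EF1_b i j; exists g; move: le_g.
  rewrite (@eq_value _ _ _ _ _ [predD1 predT & g]); last first.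
    by move=> h; rewrite /= -!topredE /= cat_lt.
  by rewrite (@eq_value _ _ _ _ (fun h => (cat h < s)%N) predT) // => h; rewrite cat_lt.
have le_s : (n * q <= s)%N by rewrite mulnC leq_addr.
have [balT fixT] := fixable_pure le_s one_b pure.
set T := [set g | _] in balT fixT.
have [r0 | r_gt0] := posnP r.
  rewrite addn0; have -> // : [set: M] = T.
  by apply/setP=> g; rewrite !inE (leq_trans (cat_lt g)) // /s r0 addn0 mulnC.
(* Each agent receives one good from each of the [s] categories, as many as it had. *)
have bal_a : balanced_on a b [set: M].
  move=> i; transitivity s.
    by rewrite -(card_a i); apply: eq_card => g; rewrite !inE.
  transitivity #|[set g | b g == i]|; last by apply: eq_card => g; rewrite !inE.
  rewrite (card_fibers (fun g => Ordinal (cat_lt g))) (eq_bigr (fun=> 1%N)) => [|c _].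
    by rewrite big_const_ord iter_addn_0 mul1n.
  rewrite -[RHS](one_b c i) //; apply: eq_card => g; rewrite !inE andbC.
  by rewrite -val_eqE.
have sr : (s - n * q = r)%N by rewrite /s mulnC addKn.
have := @trails_mixed n M a b cat s (n * q) ([set: M] :\: T).
rewrite sr => fixD; rewrite -(setID [set: M] T) setTI; apply: fixableU => //.
  by rewrite -setI_eq0 setIDA setIC -setIDA setDv setI0.
apply: fixD => //.
- by rewrite -subn_gt0 sr.
- by apply/setP=> g; rewrite !inE andbT -leqNgt.
- exact: ltnW.
by apply: balancedD => //; apply: subsetT.
Qed.

Theorem theorem5p1 (R : realType) (n s : nat) (hn : (2 <= n)%N)
    (hs : (1 <= s)%N) :
  let q := (s %/ n)%N in
  let r := (s - q * n)%N in
  exists f : nat,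
    [/\ is_f R n s f,
        f%:R <= (if r == 0%N then s%:R * (n%:R - 1) / 2
                 else s%:R * (n%:R - 1) / 2 + r%:R * (n%:R - 3) / 2 + 1 :> R)
      & n = 2%N -> f%:R <= (s%:R - r%:R) / 2 :> R].
Proof.
move=> q r; have def_s : s = (q * n + r)%N by rewrite /r subnKC // leq_divM.
have lt_rn : (r < n)%N.
  by rewrite /r {1}(divn_eq s n) addKn ltn_pmod // ltnW.
clearbody r; clearbody q.
have sR : s%:R = q%:R * n%:R + r%:R :> R by rewrite def_s natrD natrM.
have ns_gt0 : (0 < n * s)%N by rewrite muln_gt0 hs ltnW.
(* This is the claimed bound, since [r(n-1)/2 + r(n-3)/2 = r(n-2)]. *)
set K := ((q * (n * n.-1))./2 + (if r == 0 then 0 else r * (n - 2) + 1))%N.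
have suffK : exchanges_suffice R n s K.
  apply: exchanges_suffice_fixable => // M w a w_ge0 card_a x0.
  by apply: many_agents => // i; rewrite -def_s.
have suff2 : n = 2%N -> exchanges_suffice R n s q.
  (* For two agents [(s - r)/2] is [q]; for even [s] this is already [K], so only odd [s] needs the
     matchings. *)
  move=> n2; have [r0 | r_gt0] := posnP r.
    suff <- : K = q by [].
    by rewrite /K r0 n2 addn0 muln2 doubleK.
  apply: exchanges_suffice_fixable => //; move: (n2) lt_rn def_s => -> lt_r2 def_s.
  move=> M w a w_ge0 card_a _; apply: two_agents => // i.
  by rewrite card_a def_s muln2; lia.
(* The value of [f] is the least sufficient number, which exists because [K] suffices. *)
have exK : exists k, `[< exchanges_suffice R n s k >] by exists K; apply/asboolP.
case: (ex_minnP exK) => f /asboolP suff_f min_f; exists f; split.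
- by split=> // k suff_k; apply/min_f/asboolP.
- have le_fK : f%:R <= K%:R :> R by rewrite ler_nat; apply/min_f/asboolP.
  apply: le_trans le_fK _; rewrite /K natrD.
  have even_n : ~~ odd (q * (n * n.-1)).
    by rewrite !oddM; case: (n) hn => //= m _; case: (odd m); rewrite ?andbF.
  have def_half : ((q * (n * n.-1))./2)%:R = q%:R * (n%:R * (n%:R - 1)) / 2 :> R.
    have := congr1 (fun k => k%:R : R) (even_halfK even_n).
    rewrite -mul2n !natrM -subn1 natrB ?(ltnW hn) // => <-.
    by rewrite [2 * _]mulrC mulfK ?pnatr_eq0.
  rewrite def_half sR.
  case: eqP => [->|_]; first by rewrite addr0; lra.
  rewrite natrD natrM natrB //; lra.
move=> n2; apply: (@le_trans _ _ q%:R).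
  by rewrite ler_nat; apply/min_f/asboolP/suff2.
by rewrite sR n2; lra.
Qed.
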